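(* Let $R$ be a left artinian ring with Jacobson radical $J$, and let $R\text{-mod}$ be the category of finitely generated left $R$-modules. (1) If $f\colon M\to U$ is an irreducible injective map from a module $M\in R\text{-mod}$ to a uniserial module $U\in R\text{-mod}$, then there exists an isomorphism $\varphi\colon JU\to M$ such that $f\varphi$ is the natural radical embedding $JU\hookrightarrow U$. (2) If $g\colon U\to M$ is an irreducible surjective map from a uniserial module $U\in R\text{-mod}$ to a module $M\in R\text{-mod}$, then there exists an isomorphism $\psi\colon M\to U/\operatorname{soc}U$ such that $\psi g$ is the natural socle factor projection $U\to U/\operatorname{soc}U$.
   Context: A module is uniserial if it has only one composition series with simple factors. A map $f$ in $R\text{-mod}$ is irreducible if it is neither a split monomorphism nor a split epimorphism and whenever $f=gh$ in $R\text{-mod}$, either $h$ is a split monomorphism or $g$ is a split epimorphism. Maps are composed from right to left. *)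

(* Defs.v *)
From HB Require Import structures.
From mathcomp Require Import all_boot all_algebra.
From mathcomp Require Import boolp classical_sets.

Set Implicit Arguments.
Unset Strict Implicit.
Unset Printing Implicit Defensive.

Import GRing.Theory.

Local Open Scope ring_scope.

(* Submodules of V are the elements of submodClosed V. Predicates are boolean,
   but classical logic (asbool) makes every Prop-valued submodule boolean. *)

Section Submodules.
Context {R : pzRingType}.
Implicit Types V : lmodType R.

Lemma submodClosed_ext V (S T : submodClosed V) : S =i T -> S = T.
Proof.
case: S => S [[S1] [S2]]; case: T => T [[T1] [T2]] eqST.
have {eqST} eqST : S = T by apply/funext => x; exact: (eqST x).
case: T / eqST T1 T2 => T1 T2.
by rewrite (Prop_irrelevance S1 T1) (Prop_irrelevance S2 T2).
Qed.

Section Bounds.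
Variable V : lmodType R.

Definition zero_pred : {pred V} := pred1 0.

Lemma zero_pred_closed : subsemimod_closed zero_pred.
Proof.
split; first split=> [|x y].
- exact: eqxx.
- by move=> /eqP-> /eqP->; rewrite addr0 unfold_in eqxx.
- by move=> a x /eqP->; rewrite scaler0 unfold_in eqxx.
Qed.
HB.instance Definition _ :=
  GRing.isSubmodClosed.Build R V zero_pred zero_pred_closed.

Definition submod0 : submodClosed V := zero_pred.

Definition full_pred : {pred V} := predT.

Lemma full_pred_closed : subsemimod_closed full_pred.
Proof. by split; first split. Qed.
HB.instance Definition _ :=
  GRing.isSubmodClosed.Build R V full_pred full_pred_closed.

Definition submodT : submodClosed V := full_pred.

End Bounds.

Section Sub.
Variables (V : lmodType R) (S : submodClosed V).

Definition submod : Type := {x : V | x \in S}.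

HB.instance Definition _ := SubChoice.on submod.
HB.instance Definition _ := [SubChoice_isSubLmodule of submod by <:].

End Sub.

Section Quotient.
Variables (V : lmodType R) (S : submodClosed V).

(* Quotient.quot expects a zmodClosed predicate; submodClosed, which is defined
   over semirings, does not inherit from it. *)
Definition zmod_pred : {pred V} := S.
HB.instance Definition _ :=
  GRing.isSubmodClosed.Build R V zmod_pred (GRing.subsemimodClosedP S).

Definition quotmod : Type := Quotient.quot (zmod_pred : zmodClosed V).

HB.instance Definition _ := GRing.Zmodule.on quotmod.

Definition quotmod_proj (x : V) : quotmod := \pi_(Quotient.quot zmod_pred)%qT x.

Definition quotmod_scale (a : R) (x : quotmod) : quotmod :=
  quotmod_proj (a *: (repr (x : Quotient.quot zmod_pred) : V)).

Lemma quotmod_projB : {morph quotmod_proj : x y / x - y}.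
Proof. by move=> x y; rewrite /quotmod_proj raddfB. Qed.

Lemma quotmod_projD : {morph quotmod_proj : x y / x + y}.
Proof. by move=> x y; rewrite /quotmod_proj raddfD. Qed.

Lemma quotmod_projP x y : quotmod_proj x = quotmod_proj y <-> x - y \in S.
Proof.
rewrite -[x - y \in S]/(x - y \in (zmod_pred : zmodClosed V)).
by rewrite Quotient.idealrBE; split=> /eqP.
Qed.

Lemma quotmod_projK (x : quotmod) :
  quotmod_proj (repr (x : Quotient.quot zmod_pred)) = x.
Proof. exact: reprK. Qed.

Lemma quotmod_projZ a x : quotmod_proj (a *: x) = quotmod_scale a (quotmod_proj x).
Proof.
apply/quotmod_projP; rewrite -scalerBr rpredZ //.
by apply/quotmod_projP; rewrite quotmod_projK.
Qed.

Fact quotmod_scaleA a b x :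
  quotmod_scale a (quotmod_scale b x) = quotmod_scale (a * b) x.
Proof. by rewrite -[x]quotmod_projK -!quotmod_projZ scalerA. Qed.

Fact quotmod_scale1 : left_id 1 quotmod_scale.
Proof. by move=> x; rewrite -[x]quotmod_projK -quotmod_projZ scale1r. Qed.

Fact quotmod_scaleDr : right_distributive quotmod_scale +%R.
Proof.
move=> a x y; rewrite -[x]quotmod_projK -[y]quotmod_projK.
by rewrite -quotmod_projD -!quotmod_projZ scalerDr quotmod_projD.
Qed.

Fact quotmod_scaleDl x : {morph quotmod_scale^~ x : a b / a + b}.
Proof.
move=> a b; rewrite -[x]quotmod_projK.
by rewrite -!quotmod_projZ scalerDl quotmod_projD.
Qed.

HB.instance Definition _ := GRing.Zmodule_isLmodule.Build R quotmod
  quotmod_scaleA quotmod_scale1 quotmod_scaleDr quotmod_scaleDl.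

HB.instance Definition _ :=
  GRing.isZmodMorphism.Build V quotmod quotmod_proj quotmod_projB.
HB.instance Definition _ :=
  GRing.isScalable.Build R V quotmod *:%R quotmod_proj quotmod_projZ.

End Quotient.

Section Span.
Variables (V : lmodType R) (X : set V).

Definition submod_span_pred : {pred V} := fun v =>
  `[< exists n (a : 'I_n -> R) (x : 'I_n -> V),
        (forall i, X (x i)) /\ v = \sum_(i < n) a i *: x i >].

Lemma submod_span_pred_closed : subsemimod_closed submod_span_pred.
Proof.
split; first split.
- apply/asboolP; exists 0, (fun=> 0), (fun=> 0).
  by split; [case | rewrite big_ord0].
- move=> _ _ /asboolP[n [a [x [Xx ->]]]] /asboolP[m [b [y [Xy ->]]]].
  apply/asboolP; exists (n + m)%N.
  exists (fun k => match split k with inl i => a i | inr j => b j end).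
  exists (fun k => match split k with inl i => x i | inr j => y j end).
  split=> [k|]; first by case: (split k).
  rewrite big_split_ord /=; congr (_ + _); apply: eq_bigr => i _.
    by rewrite (unsplitK (inl i)).
  by rewrite (unsplitK (inr i)).
- move=> c _ /asboolP[n [a [x [Xx ->]]]].
  apply/asboolP; exists n, (fun i => c * a i), x; split=> //.
  by rewrite scaler_sumr; apply: eq_bigr => i _; rewrite scalerA.
Qed.
HB.instance Definition _ :=
  GRing.isSubmodClosed.Build R V submod_span_pred submod_span_pred_closed.

Definition submod_span : submodClosed V := submod_span_pred.

End Span.

Section Factor.
Variables (V : lmodType R) (A B : submodClosed V).

(* The intersection of A and B, as a submodule of B. *)
Definition trace_pred : {pred submod B} := fun x => val x \in A.

Lemma trace_pred_closed : subsemimod_closed trace_pred.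
Proof.
split; first split=> [|x y].
- exact: (rpred0 A).
- exact: (rpredD (S := A)).
- by move=> a x; exact: (rpredZ (s := A)).
Qed.
HB.instance Definition _ :=
  GRing.isSubmodClosed.Build R (submod B) trace_pred trace_pred_closed.

(* B / A; used only when A is contained in B. *)
Definition factor : lmodType R := quotmod (trace_pred : submodClosed (submod B)).

End Factor.

Definition fin_gen V := exists s : seq V, submod_span [set x | x \in s] =i predT.

Definition simple_mod V :=
  (exists v : V, v != 0) /\
  forall S : submodClosed V, S =i submod0 V \/ S =i submodT V.

(* s lists V_1, ..., V_n in 0 = V_0 < V_1 < ... < V_n = V. *)
Definition comp_series V (s : seq (submodClosed V)) :=
  last (submod0 V) s =i submodT V /\
  forall i, (i < size s)%N ->
    let A := nth (submod0 V) (submod0 V :: s) i in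
    let B := nth (submod0 V) s i in
    {subset A <= B} /\ simple_mod (factor A B).

Definition uniserial V :=
  exists! s : seq (submodClosed V), comp_series s.

Definition socle V : submodClosed V :=
  submod_span [set v | exists S : submodClosed V, simple_mod (submod S) /\ v \in S].

Section Maps.
Variables (M N : lmodType R).

Definition split_mono (f : {linear M -> N}) :=
  exists r : {linear N -> M}, cancel f r.

Definition split_epi (f : {linear M -> N}) :=
  exists s : {linear N -> M}, cancel s f.

End Maps.

Definition irreducible_map (M N : lmodType R) (f : {linear M -> N}) :=
  [/\ ~ split_mono f, ~ split_epi f &
      forall (X : lmodType R) (g : {linear X -> N}) (h : {linear M -> X}),
        fin_gen X -> f =1 g \o h -> split_mono h \/ split_epi g].

End Submodules.

Arguments submod0 {R} V.
Arguments submodT {R} V.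
Arguments socle {R} V.

(* R^o is R as a left module over itself, so submodClosed R^o is the type of
   left ideals of R. *)

Definition left_artinian (R : pzRingType) :=
  forall I : nat -> submodClosed R^o,
    (forall n, {subset I n.+1 <= I n}) ->
    exists n, forall m, (n <= m)%N -> I m =i I n.

Definition max_left_ideal (R : pzRingType) (L : submodClosed R^o) :=
  ~ (L =i submodT R^o) /\
  forall L' : submodClosed R^o,
    {subset L <= L'} -> L' =i L \/ L' =i submodT R^o.

Definition jacobson (R : pzRingType) : set R :=
  [set a | forall L : submodClosed R^o, max_left_ideal L -> (a : R^o) \in L].

Definition rad_mul (R : pzRingType) (V : lmodType R) : submodClosed V :=
  submod_span [set v | exists a u, jacobson a /\ v = a *: u].
Arguments rad_mul {R} V.

(* Main.v *)
From HB Require Import structures.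
Require Import Defs.
From mathcomp Require Import all_boot all_algebra.
From mathcomp Require Import boolp.

Set Implicit Arguments.
Unset Strict Implicit.
Unset Printing Implicit Defensive.

Import GRing.Theory.

Local Open Scope ring_scope.

(** The submodules of a uniserial module [U] are exactly the terms of its
    composition series ([uniserial_flag]): intersecting a composition series
    with a submodule [S], and adding [S] to it, gives a series from [0] to [S]
    and one from [S] to [U] whose steps are simple or trivial, so [S] is a term
    of some composition series, hence of the only one.  Consequently the
    submodules of [U] form a chain, each of them is cyclic, and a nonzero [U]
    has a largest proper submodule [P] and a least nonzero submodule [Q]
    ([uniserial_structure]).

    Let [f : M -> U] be irreducible and injective.  It is not surjective, so its
    image lies in [P] and [f] factors through the inclusion of [P].  That
    inclusion is not a split epimorphism, hence [M -> P] is a split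
    monomorphism; as the submodules of [P] form a chain, a direct summand of [P]
    is [0] or [P] ([chain_summand]), and it is not [0] because the map from [0]
    splits.  So [f] is injective with image [P], and it remains to see that
    [P = J U] ([rad_mul_local]).  This is the only use of the artinian
    condition: it provides, for every left ideal [L], a left ideal [C] with
    [L + C = R] and [L] meeting [C] inside [J] ([left_supplement]), which is the
    semisimplicity of [R / J] in elementary form.

    Dually, an irreducible surjective [g : U -> M] is not injective, so its
    kernel contains [Q] and [g] factors through [U / Q]; the projection onto
    [U / Q] is not a split monomorphism, so [U / Q -> M] is a split epimorphism
    out of a module whose submodules form a chain, hence bijective.  Finally [Q]
    is the socle of [U] ([socle_least]). *)

(** * Submodules *)

Section Modules.
Context {R : pzRingType}.
Implicit Types (V W : lmodType R).

Lemma submodN V (S : submodClosed V) x : x \in S -> - x \in S.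
Proof. by rewrite -scaleN1r; exact: rpredZ. Qed.

Lemma submodB V (S : submodClosed V) x y : x \in S -> y \in S -> x - y \in S.
Proof. by move=> Sx Sy; rewrite rpredD ?submodN. Qed.

Lemma submod_anti V (S T : submodClosed V) :
  {subset S <= T} -> {subset T <= S} -> S = T.
Proof.
by move=> sST sTS; apply: submodClosed_ext => x; apply/idP/idP => [/sST|/sTS].
Qed.

Lemma mem_submod0 V (x : V) : (x \in submod0 V) = (x == 0).
Proof. by []. Qed.

Lemma sub_submod0 V (S : submodClosed V) : {subset submod0 V <= S}.
Proof. by move=> x; rewrite mem_submod0 => /eqP->; exact: rpred0. Qed.

Lemma not_submodT V (S : submodClosed V) :
  S <> submodT V -> exists x, x \notin S.
Proof.
move=> neqST; apply: contrapT => /forallNP allS; apply: neqST.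
apply: submod_anti => // x _; exact/negPn/negP/allS.
Qed.

Section Image.
Variables (V W : lmodType R) (f : {linear V -> W}) (S : submodClosed V).

Definition image_pred : {pred W} := fun y => `[< exists2 x, x \in S & f x = y >].

Lemma image_pred_closed : subsemimod_closed image_pred.
Proof.
split; first split.
- by apply/asboolP; exists 0; rewrite ?rpred0 ?linear0.
- move=> _ _ /asboolP[x Sx <-] /asboolP[y Sy <-]; apply/asboolP.
  by exists (x + y); rewrite ?rpredD ?linearD.
- move=> a _ /asboolP[x Sx <-]; apply/asboolP.
  by exists (a *: x); rewrite ?rpredZ ?linearZ.
Qed.
HB.instance Definition _ :=
  GRing.isSubmodClosed.Build R W image_pred image_pred_closed.

Definition submod_image : submodClosed W := image_pred.

Lemma submod_imageP y : reflect (exists2 x, x \in S & f x = y) (y \in submod_image).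
Proof. exact: asboolP. Qed.

End Image.

Section Preimage.
Variables (V W : lmodType R) (f : {linear V -> W}) (S : submodClosed W).

Definition preim_pred : {pred V} := fun x => f x \in S.

Lemma preim_pred_closed : subsemimod_closed preim_pred.
Proof.
split; first split=> [|x y Sx Sy].
- by rewrite -[_ \in _]/(f 0 \in S) linear0 rpred0.
- by rewrite -[_ \in _]/(f (x + y) \in S) linearD rpredD.
- by move=> a x Sx; rewrite -[_ \in _]/(f (a *: x) \in S) linearZ rpredZ.
Qed.
HB.instance Definition _ :=
  GRing.isSubmodClosed.Build R V preim_pred preim_pred_closed.

Definition submod_preim : submodClosed V := preim_pred.

Lemma mem_submod_preim x : (x \in submod_preim) = (f x \in S).
Proof. by []. Qed.

End Preimage.

Section MeetJoin.
Variables (V : lmodType R) (S T : submodClosed V).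

Definition cap_pred : {pred V} := fun x => (x \in S) && (x \in T).

Lemma cap_pred_closed : subsemimod_closed cap_pred.
Proof.
split; first split=> [|x y /andP[Sx Tx] /andP[Sy Ty]].
- by apply/andP; rewrite !rpred0.
- by apply/andP; rewrite !rpredD.
- by move=> a x /andP[Sx Tx]; apply/andP; rewrite !rpredZ.
Qed.
HB.instance Definition _ :=
  GRing.isSubmodClosed.Build R V cap_pred cap_pred_closed.

Definition submod_cap : submodClosed V := cap_pred.

Lemma mem_submod_cap x : (x \in submod_cap) = (x \in S) && (x \in T).
Proof. by []. Qed.

Definition add_pred : {pred V} := fun x => `[< exists2 y, y \in S & x - y \in T >].

Lemma add_pred_closed : subsemimod_closed add_pred.
Proof.
split; first split.
- by apply/asboolP; exists 0; rewrite ?subr0 rpred0.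
- move=> x y /asboolP[s Ss Tx] /asboolP[t St Ty]; apply/asboolP.
  exists (s + t); first exact: rpredD.
  by rewrite opprD addrACA rpredD.
- move=> a x /asboolP[s Ss Tx]; apply/asboolP.
  by exists (a *: s); rewrite -?scalerBr rpredZ.
Qed.
HB.instance Definition _ :=
  GRing.isSubmodClosed.Build R V add_pred add_pred_closed.

Definition submod_add : submodClosed V := add_pred.

Lemma submod_addP x : reflect (exists2 y, y \in S & x - y \in T) (x \in submod_add).
Proof. exact: asboolP. Qed.

Lemma submod_addl : {subset S <= submod_add}.
Proof. by move=> x Sx; apply/submod_addP; exists x; rewrite // subrr rpred0. Qed.

Lemma submod_addr : {subset T <= submod_add}.
Proof. by move=> x Tx; apply/submod_addP; exists 0; rewrite ?subr0 ?rpred0. Qed.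

End MeetJoin.

(** * Cyclic and finitely generated modules *)

Section Cyclic.
Variables (V : lmodType R) (u : V).

(** Taking [R^o] as the domain makes annihilator-like left ideals
    [{a | a u \in S}] preimages and the submodule [R u] an image. *)
Definition orbit_map (a : R^o) : V := (a : R) *: u.

Lemma orbit_map_is_linear : linear orbit_map.
Proof. by move=> a x y; rewrite /orbit_map scalerDl -scalerA. Qed.
HB.instance Definition _ :=
  GRing.isLinear.Build R R^o V *:%R orbit_map orbit_map_is_linear.

Lemma orbit_map1 : orbit_map 1 = u.
Proof. exact: scale1r. Qed.

Definition cyclic_submod : submodClosed V := submod_image orbit_map (submodT R^o).

Lemma cyclic_submodP x : reflect (exists a : R, x = a *: u) (x \in cyclic_submod).
Proof.
by apply: (iffP (submod_imageP _ _ _)) => [[a _ <-]|[a ->]]; exists a.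
Qed.

Lemma mem_cyclic : u \in cyclic_submod.
Proof. by apply/cyclic_submodP; exists 1; rewrite scale1r. Qed.

End Cyclic.

Lemma fin_gen_cyclic V (S : submodClosed V) u :
  u \in S -> {subset S <= cyclic_submod u} -> fin_gen (submod S).
Proof.
move=> Su sSu; pose v : submod S := Sub u Su.
exists [:: v] => x; apply/asboolP.
have /cyclic_submodP[a def_x] := sSu _ (valP x).
exists 1%N, (fun=> a), (fun=> v); split=> [i|]; first exact: mem_head.
by rewrite big_ord1; apply: val_inj; rewrite linearZ.
Qed.

Lemma fin_gen_quot V (S : submodClosed V) : fin_gen V -> fin_gen (quotmod S).
Proof.
case=> s gen_s; exists [seq quotmod_proj S x | x <- s] => y; apply/asboolP.
have /asboolP[n [a [x [sx def_y]]]] := gen_s (repr (y : Quotient.quot (zmod_pred S))).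
exists n, a, (fun i => quotmod_proj S (x i)); split=> [i|].
  exact/map_f/sx.
rewrite -[y]quotmod_projK def_y linear_sum.
by apply: eq_bigr => i _; rewrite linearZ.
Qed.

(** * Factoring linear maps *)

Lemma lift_mono (A B C : lmodType R) (f : {linear A -> C}) (h : {linear B -> C}) :
    injective f -> (forall b, exists a, f a = h b) ->
  exists k : {linear B -> A}, forall b, f (k b) = h b.
Proof.
move=> f_inj /choice[k fk]; have k_lin : linear k.
  by move=> a x y; apply: f_inj; rewrite linearP !fk linearP.
pose K := GRing.isLinear.Build R B A *:%R k k_lin.
by exists (HB.pack k K : {linear B -> A}).
Qed.

Lemma factor_epi (A B C : lmodType R) (g : {linear A -> B}) (h : {linear A -> C}) :
    (forall y, exists x, g x = y) -> (forall x, g x = 0 -> h x = 0) ->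
  exists k : {linear B -> C}, forall x, k (g x) = h x.
Proof.
move=> /choice[s gs] ker_gh.
have hE x y : g x = g y -> h x = h y.
  move=> /eqP; rewrite -subr_eq0 -linearB => /eqP/ker_gh/eqP.
  by rewrite linearB subr_eq0 => /eqP.
have k_lin : linear (fun y => h (s y)).
  by move=> a x y; rewrite -linearP; apply: hE; rewrite linearP !gs.
pose K := GRing.isLinear.Build R B C *:%R _ k_lin.
exists (HB.pack (fun y => h (s y)) K : {linear B -> C}) => x /=.
exact/hE/gs.
Qed.

Lemma linear_inverse (A B : lmodType R) (f : {linear A -> B}) :
    injective f -> (forall y, exists x, f x = y) ->
  exists k : {linear B -> A}, cancel f k /\ cancel k f.
Proof.
move=> f_inj f_surj; have [k fk] := lift_mono (h := idfun) f_inj f_surj.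
by exists k; split=> // x; apply: f_inj; exact: fk.
Qed.

Lemma ker0_inj (A B : lmodType R) (f : {linear A -> B}) :
  (forall x, f x = 0 -> x = 0) -> injective f.
Proof.
move=> ker0 x y /eqP; rewrite -subr_eq0 -linearB => /eqP/ker0/eqP.
by rewrite subr_eq0 => /eqP.
Qed.

(** * Modules whose submodules form a chain *)

Definition chain_module V :=
  forall S T : submodClosed V, {subset S <= T} \/ {subset T <= S}.

Lemma chain_submod V (S : submodClosed V) : chain_module V -> chain_module (submod S).
Proof.
move=> chV A B.
have sub_image (A' B' : submodClosed (submod S)) :
    {subset submod_image val A' <= submod_image val B'} -> {subset A' <= B'}.
  move=> sAB x Ax; have /sAB/submod_imageP[y By /val_inj<- //] :
    val x \in submod_image val A' by apply/submod_imageP; exists x.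
by case: (chV (submod_image val A) (submod_image val B)) => /sub_image; [left|right].
Qed.

Lemma chain_quot V (S : submodClosed V) : chain_module V -> chain_module (quotmod S).
Proof.
move=> chV A B; pose p := quotmod_proj S.
have sub_preim (A' B' : submodClosed (quotmod S)) :
    {subset submod_preim p A' <= submod_preim p B'} -> {subset A' <= B'}.
  by move=> sAB x; rewrite -[x]quotmod_projK => /(sAB _).
by case: (chV (submod_preim p A) (submod_preim p B)) => /sub_preim; [left|right].
Qed.

(** The image of [h] and the kernel of [r] are complementary summands of [X];
    one contains the other, so the smaller one vanishes. *)
Lemma chain_summand (M X : lmodType R) (h : {linear M -> X}) (r : {linear X -> M}) :
  chain_module X -> cancel h r -> (forall m : M, m = 0) \/ cancel r h.
Proof.
move=> chX hK.
case: (chX (submod_image h (submodT M)) (submod_preim r (submod0 M))) => sub.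
  left=> m; have /sub : h m \in submod_image h (submodT M).
    by apply/submod_imageP; exists m.
  by rewrite mem_submod_preim hK => /eqP.
right=> x; have /sub/submod_imageP[m _ hm] :
    x - h (r x) \in submod_preim r (submod0 M).
  by rewrite mem_submod_preim linearB hK subrr rpred0.
have m0 : m = 0 by rewrite -[m]hK hm linearB hK subrr.
by apply/esym/eqP; rewrite -subr_eq0 -hm m0 linear0.
Qed.

(** * Simple factors as covers in the lattice of submodules *)

(** Equality [A = B] is permitted, because meets and joins with a fixed submodule
    preserve this relation but may collapse a strict step. *)
Definition weak_cover V (A B : submodClosed V) :=
  {subset A <= B} /\
  forall S : submodClosed V,
    {subset A <= S} -> {subset S <= B} -> S = A \/ S = B.

(** Submodules of [B / A] correspond to the submodules between [A] and [B]. *)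
Lemma simple_factorP V (A B : submodClosed V) : {subset A <= B} ->
  simple_mod (factor A B) <-> A <> B /\ weak_cover A B.
Proof.
move=> sAB; pose p : {linear submod B -> factor A B} :=
    quotmod_proj (@trace_pred R V A B : submodClosed (submod B)).
have p_eq x y : p x = p y <-> val x - val y \in A.
  by rewrite -linearB; exact: quotmod_projP.
have p0 x : p x = 0 <-> val x \in A.
  have := p_eq x 0; rewrite linear0 (_ : val x - val 0 = val x) ?subr0 //; exact.
have pK (y : factor A B) : exists x, p x = y.
  by eexists; exact: quotmod_projK.
split=> [[[y y0] simpAB]|[neqAB [_ covAB]]].
  split.
    move=> eqAB; have [x def_y] := pK y; case/eqP: y0; rewrite -def_y.
    by apply/p0; rewrite eqAB; exact: valP.
  split=> // S sAS sSB.
  case: (simpAB (submod_image p (submod_preim (val : submod B -> V) S))) => [img0|imgT].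
    left; apply: submod_anti => // x Sx.
    have /p0 : p (Sub x (sSB x Sx)) = 0; last by [].
    apply/eqP; rewrite -mem_submod0 -img0; apply/submod_imageP.
    by exists (Sub x (sSB x Sx)).
  right; apply: submod_anti => // x Bx.
  have : p (Sub x Bx) \in submodT (factor A B) by [].
  rewrite -imgT => /submod_imageP[s Ss /p_eq /sAS].
  by rewrite /= => Ssx; rewrite -(subKr (val s) x) submodB.
split.
  apply: contrapT => /forallNP all0; apply: neqAB; apply: submod_anti => // x Bx.
  have /p0 // : p (Sub x Bx) = 0.
  exact/eqP/negPn/negP/all0.
move=> T; pose S := submod_image (val : submod B -> V) (submod_preim p T).
have sAS : {subset A <= S}.
  move=> x Ax; apply/submod_imageP; exists (Sub x (sAB x Ax)) => //.
  by rewrite mem_submod_preim (_ : p _ = 0) ?rpred0 //; exact/p0.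
have sSB : {subset S <= B} by move=> _ /submod_imageP[x _ <-]; exact: valP.
have inS x : (val x \in S) = (p x \in T).
  apply/submod_imageP/idP => [[y Ty /val_inj <- //]|Tx]; by exists x.
case: (covAB S sAS sSB) => defS; [left|right] => y; have [x <-] := pK y.
  by rewrite -inS defS mem_submod0; apply/idP/eqP => /p0.
by rewrite -inS defS; exact: valP.
Qed.

(** If [T] lies between the two meets then [A + T] lies between [A] and [B], and
    the modular law recovers [T] from [A + T]. *)
Lemma weak_cover_cap V (S A B : submodClosed V) :
  weak_cover A B -> weak_cover (submod_cap S A) (submod_cap S B).
Proof.
move=> [sAB cov]; split=> [x|T sT Ts].
  by rewrite !mem_submod_cap => /andP[-> /sAB].
have sTS x : x \in T -> x \in S by move/Ts; rewrite mem_submod_cap => /andP[].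
have sTB x : x \in T -> x \in B by move/Ts; rewrite mem_submod_cap => /andP[].
have [||eqA|eqB] := cov (submod_add A T); first exact: submod_addl.
- move=> x /submod_addP[a Aa Tx]; rewrite -(subrK a x) rpredD //; first exact: sTB.
  exact: sAB.
- left; apply: submod_anti => // x Tx; rewrite mem_submod_cap sTS //= -eqA.
  exact: submod_addr.
right; apply: submod_anti => // x; rewrite mem_submod_cap -eqB.
move=> /andP[Sx /submod_addP[a Aa Tx]]; rewrite -(subrK a x) rpredD //.
apply: sT; rewrite mem_submod_cap Aa andbT -(subKr x a) submodB //.
exact: sTS.
Qed.

(** Dually, [T] between the two sums is recovered from its meet with [B]. *)
Lemma weak_cover_add V (S A B : submodClosed V) :
  weak_cover A B -> weak_cover (submod_add S A) (submod_add S B).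
Proof.
move=> [sAB cov]; split=> [x /submod_addP[s Ss /sAB Bx]|T sT Ts].
  by apply/submod_addP; exists s.
have sST x : x \in S -> x \in T by move=> Sx; apply: sT; exact: submod_addl.
have sAT x : x \in A -> x \in T by move=> Sx; apply: sT; exact: submod_addr.
have [||eqA|eqB] := cov (submod_cap T B).
- by move=> x Ax; rewrite mem_submod_cap sAT ?sAB.
- by move=> x; rewrite mem_submod_cap => /andP[].
- left; apply: submod_anti => // x Tx; have /submod_addP[s Ss Bx] := Ts x Tx.
  apply/submod_addP; exists s => //; rewrite -eqA mem_submod_cap Bx andbT.
  by rewrite submodB // sST.
right; apply: submod_anti => // x /submod_addP[s Ss].
rewrite -eqB mem_submod_cap => /andP[Tx _].
by rewrite -(subrK s x) rpredD // sST.
Qed.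

(** * Composition series through a given submodule *)

Fixpoint series V (A : submodClosed V) (s : seq (submodClosed V)) : Prop :=
  if s is B :: s' then [/\ A <> B, weak_cover A B & series B s'] else True.

Lemma series_cat V (A : submodClosed V) s t :
  series A (s ++ t) <-> series A s /\ series (last A s) t.
Proof.
elim: s A => [|B s IHs] A /=; first by split=> [|[]].
split=> [[neqAB covAB /IHs[]]|[[neqAB covAB serB] serC]]; first by split.
by split=> //; apply/IHs.
Qed.

Definition series_between V (A B : submodClosed V) :=
  exists2 s, series A s & last A s = B.

Lemma series_between_trans V (A B C : submodClosed V) :
  series_between A B -> series_between B C -> series_between A C.
Proof.
move=> [s serA <-] [t serB <-]; exists (s ++ t); last by rewrite last_cat.
exact/series_cat.
Qed.

Lemma series_between_cover V (A B : submodClosed V) : weak_cover A B -> series_between A B.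
Proof.
move=> covAB; have [eqAB|neqAB] := pselect (A = B); first by exists [::].
by exists [:: B].
Qed.

Lemma series_between_map V (F : submodClosed V -> submodClosed V) (A B : submodClosed V) :
    (forall C D, weak_cover C D -> weak_cover (F C) (F D)) ->
  series_between A B -> series_between (F A) (F B).
Proof.
move=> covF [s serA <-]; elim: s A serA => [|C s IHs] A /=; first by exists [::].
by case=> _ /covF/series_between_cover conAC /IHs; exact: series_between_trans.
Qed.

Lemma comp_seriesP V (s : seq (submodClosed V)) :
  comp_series s <-> last (submod0 V) s = submodT V /\ series (submod0 V) s.
Proof.
suff series_nth A0 A : (forall i, (i < size s)%N ->
    {subset nth A0 (A :: s) i <= nth A0 s i} /\
    simple_mod (factor (nth A0 (A :: s) i) (nth A0 s i))) <-> series A s.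
  split=> [[/submodClosed_ext lastT /series_nth //]|[lastT serS]].
  split=> [x|]; last exact: (series_nth (submod0 V) _).2.
  exact: (congr1 (fun S : submodClosed V => x \in S) lastT).
elim: s A => [|B s IHs] A /=; first by split.
split=> [H|[neqAB covAB /IHs H] [|i] lti]; last exact: H.
  have [sAB /(simple_factorP sAB)[neqAB covAB]] := H 0%N isT.
  by split=> //; apply/IHs => i lti; exact: (H i.+1).
by split; [exact: covAB.1 | apply/simple_factorP => //; exact: covAB.1].
Qed.

(** The meets of [S] with the terms of a composition series climb from [0] to [S],
    and their sums with [S] climb from [S] to [V]. *)
Lemma mem_comp_series V (S : submodClosed V) :
    series_between (submod0 V) (submodT V) ->
  exists s t, comp_series (s ++ t) /\ last (submod0 V) s = S.
Proof.
move=> con.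
have [s ser_s last_s] : series_between (submod0 V) S.
  have := series_between_map (@weak_cover_cap V S) con.
  rewrite (_ : submod_cap S (submod0 V) = submod0 V); last first.
    apply: submod_anti; last exact: sub_submod0.
    by move=> x; rewrite mem_submod_cap => /andP[].
  rewrite (_ : submod_cap S (submodT V) = S) //.
  by apply: submod_anti => x; rewrite mem_submod_cap ?andbT // => /andP[].
have [t ser_t last_t] : series_between S (submodT V).
  have := series_between_map (@weak_cover_add V S) con.
  rewrite (_ : submod_add S (submod0 V) = S); last first.
    apply: submod_anti; last exact: submod_addl.
    move=> x /submod_addP[y Sy]; rewrite mem_submod0 subr_eq0 => /eqP->.
    exact: Sy.
  rewrite (_ : submod_add S (submodT V) = submodT V) //.
  by apply: submod_anti => // x; exact: submod_addr.
exists s, t; split=> //; apply/comp_seriesP; rewrite last_cat last_s.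
by split=> //; apply/series_cat; rewrite last_s.
Qed.

(** * Submodules of a uniserial module *)

Lemma uniserial_flag V : uniserial V ->
  exists (n : nat) (W : nat -> submodClosed V),
    [/\ W 0%N = submod0 V, W n = submodT V,
        forall i, (i < n)%N -> {subset W i <= W i.+1},
        forall i, (i < n)%N -> W i <> W i.+1 &
        forall S, exists2 i, (i <= n)%N & S = W i].
Proof.
move=> [s [comp_s uniq_s]]; have [last_s ser_s] := (comp_seriesP s).1 comp_s.
have step i : (i < size s)%N ->
    nth (submod0 V) (submod0 V :: s) i <> nth (submod0 V) s i /\
    {subset nth (submod0 V) (submod0 V :: s) i <= nth (submod0 V) s i}.
  by move=> lti; have [sub /(simple_factorP sub)[]] := comp_s.2 i lti.
exists (size s), (nth (submod0 V) (submod0 V :: s)); split=> //.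
- by rewrite nth_last.
- by move=> i /step[].
- by move=> i /step[].
move=> S; have con : series_between (submod0 V) (submodT V) by exists s.
have [a [b [/uniq_s -> <-]]] := mem_comp_series S con.
exists (size a); first by rewrite size_cat leq_addr.
by rewrite -cat_cons nth_cat ltnSn -last_nth.
Qed.

(** Everything is read off the flag [W 0 < ... < W n].  A nonzero submodule
    [W i.+1] is generated by any of its elements outside [W i]; the largest
    proper submodule is [W n.-1] and the least nonzero one is [W 1].  The
    submodule [S] in the last two clauses only serves to exclude the zero
    module. *)
Lemma uniserial_structure V : uniserial V ->
  [/\ chain_module V,
      forall S : submodClosed V, fin_gen (submod S),
      forall S : submodClosed V, S <> submodT V ->
        exists2 P : submodClosed V, P <> submodT V &
          forall T : submodClosed V, T <> submodT V -> {subset T <= P} &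
      forall S : submodClosed V, S <> submod0 V ->
        exists2 Q : submodClosed V, Q <> submod0 V &
          forall T : submodClosed V, T <> submod0 V -> {subset Q <= T}].
Proof.
move=> /uniserial_flag[n [W [W0 Wn Wsub Wneq all_W]]].
have Wmono i j : (i <= j)%N -> (j <= n)%N -> {subset W i <= W j}.
  move=> leij; elim: j leij => [|j IHj]; first by rewrite leqn0 => /eqP-> _ x.
  rewrite leq_eqVlt => /predU1P[-> _ x //|ltij] ltj x /(IHj ltij (ltnW ltj)).
  exact: Wsub.
split.
- move=> S T; have [i lei ->] := all_W S; have [j lej ->] := all_W T.
  by case: (leqP i j) => [leij|/ltnW leji]; [left|right]; apply: Wmono.
- move=> S; have [[|i] lei ->] := all_W S.
    rewrite W0; apply: (@fin_gen_cyclic _ _ 0); first exact: rpred0.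
    exact: sub_submod0.
  have [x Wx nWx] : exists2 x, x \in W i.+1 & x \notin W i.
    apply: contrapT => nex; apply: (Wneq i lei); apply: submod_anti.
      exact: Wsub.
    by move=> x Wx; apply/negPn/negP => nWx; apply: nex; exists x.
  apply: (fin_gen_cyclic Wx); have [j lej defC] := all_W (cyclic_submod x).
  rewrite defC; apply: (Wmono i.+1) => //; rewrite ltnNge; apply/negP => leji.
  case/negP: nWx; apply: (Wmono j) => //; first exact: ltnW.
  by rewrite -defC mem_cyclic.
- move=> S; have [i0 lei0 ->] := all_W S.
  case: n Wn Wsub Wneq all_W Wmono lei0 => [|n] Wn Wsub Wneq all_W Wmono.
    by rewrite leqn0 => /eqP->.
  move=> _ _; exists (W n); first by rewrite -Wn; exact: Wneq.
  move=> T; have [i lei ->] := all_W T.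
  move: lei; rewrite leq_eqVlt => /predU1P[-> _ x //|lti] _.
  by apply: Wmono.
- move=> S; have [i0 lei0 ->] := all_W S.
  case: n Wn Wsub Wneq all_W Wmono lei0 => [|n] Wn Wsub Wneq all_W Wmono.
    by rewrite leqn0 => /eqP->.
  move=> _ _; exists (W 1%N); first by rewrite -W0; apply: nesym; exact: Wneq.
  move=> T; have [[|i] lei ->] := all_W T; first by rewrite W0.
  by move=> _; apply: Wmono.
Qed.

(** * The socle and the radical *)

(** A simple submodule contains [Q] because it is nonzero, and equals it by
    simplicity; [Q] itself is simple by minimality. *)
Lemma socle_least V (Q : submodClosed V) : Q <> submod0 V ->
    (forall T : submodClosed V, T <> submod0 V -> {subset Q <= T}) ->
  socle V = Q.
Proof.
move=> Q0 minQ; apply: submod_anti.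
  move=> _ /asboolP[n [a [x [sx ->]]]]; apply: rpred_sum => i _; apply: rpredZ.
  have [S [[[v v0] simpS] Sx]] := sx i.
  have sQS : {subset Q <= S}.
    apply: minQ => S0; case/eqP: v0; apply: val_inj; apply/eqP.
    by rewrite linear0 -mem_submod0 -S0; exact: valP.
  case: (simpS (submod_preim (val : submod S -> V) Q)) => defQ.
    case: Q0; apply: submod_anti; last exact: sub_submod0.
    move=> y Qy; have : Sub y (sQS y Qy) \in submod_preim (val : submod S -> V) Q by [].
    by rewrite defQ mem_submod0 => /eqP/(congr1 val) /= ->; exact: rpred0.
  have : Sub (x i) Sx \in submodT (submod S) by [].
  by rewrite -defQ.
move=> x Qx; apply/asboolP; exists 1%N, (fun=> 1), (fun=> x).
rewrite big_ord1 scale1r; split=> // _; exists Q; split=> //; split.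
  apply: contrapT => /forallNP all0; apply: Q0.
  apply: submod_anti; last exact: sub_submod0.
  move=> y Qy; have : Sub y Qy = 0 :> submod Q by exact/eqP/negPn/negP/all0.
  by move/(congr1 val) => /= ->; exact: rpred0.
move=> S; have [S0|S0] := pselect (submod_image (val : submod Q -> V) S = submod0 V).
  left=> y; rewrite mem_submod0; apply/idP/eqP => [Sy|->]; last exact: rpred0.
  apply: val_inj; apply/eqP; rewrite linear0 -mem_submod0 -S0.
  by apply/submod_imageP; exists y.
right=> y; apply/idP; have /submod_imageP[z Sz /val_inj <- //] := minQ _ S0 _ (valP y).
Qed.

Lemma artinian_minimal (P : submodClosed R^o -> Prop) C0 :
    left_artinian R -> P C0 ->
  exists2 C, P C & forall D : submodClosed R^o, {subset D <= C} -> P D -> {subset C <= D}.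
Proof.
move=> artR PC0; apply: contrapT => noMin.
have next (C : {C | P C}) : {D : {D | P D} |
    {subset sval D <= sval C} /\ ~ {subset sval C <= sval D}}.
  case: C => C PC; apply: cid; apply: contrapT => noNext; apply: noMin.
  exists C => // D sDC PD; apply: contrapT => nsCD; apply: noNext.
  by exists (exist _ D PD).
have [I [_ dec]] := dependent_choice next (exist _ C0 PC0).
have [n stat] := artR (fun n => sval (I n)) (fun n => (dec n).1).
by case: (dec n) => _; apply=> x; rewrite -(stat n.+1 (leqnSn n)).
Qed.

(** Take [C] minimal with [L + C = R].  If a maximal left ideal [M] did not contain
    the meet [N] of [L] and [C], then [N + M = R]; writing [1 = z + m] there, each
    [c] in [C] is [c z + c m] with [c z] in [L] and [c m] in both [C] and [M].
    So [L] plus the meet of [C] and [M] is still [R], and minimality puts [C],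
    hence [N], inside [M]. *)
Lemma left_supplement (L : submodClosed R^o) : left_artinian R ->
  exists C : submodClosed R^o,
    submod_add L C = submodT R^o /\ forall x, x \in submod_cap L C -> jacobson x.
Proof.
move=> artR; pose P C := submod_add L C = submodT R^o.
have PT : P (submodT R^o) by apply: submod_anti => // x; exact: submod_addr.
have [C PC minC] := artinian_minimal artR PT.
exists C; split=> // x LCx M maxM; apply: contrapT => nMx.
have LCM : submod_add (submod_cap L C) M = submodT R^o.
  apply: submodClosed_ext; have [] := maxM.2 (submod_add (submod_cap L C) M).
  - exact: submod_addr.
  - by move=> defM; case: nMx; rewrite -defM; exact: submod_addl.
  - by [].
have sCCM : {subset C <= submod_cap C M}.
  apply: minC => [y|]; first by rewrite mem_submod_cap => /andP[].
  apply: submod_anti => // y _.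
  have : (1 : R^o) \in submod_add (submod_cap L C) M by rewrite LCM.
  case/submod_addP=> z; rewrite mem_submod_cap => /andP[Lz Cz] Mz.
  have : y \in submod_add L C by rewrite PC.
  case/submod_addP=> l Ll Cyl; apply/submod_addP; set c := y - l in Cyl.
  exists (l + c *: z); first by rewrite rpredD ?rpredZ.
  rewrite opprD addrA -/c; have -> : c - c *: z = c *: (1 - z).
    by rewrite scalerBr; congr (_ - _); rewrite -[LHS]mulr1.
  rewrite mem_submod_cap [X in _ && X]rpredZ // andbT scalerBr.
  by rewrite [X in X - _](mulr1 c) submodB ?rpredZ.
apply: nMx; move: LCx; rewrite mem_submod_cap => /andP[_ /sCCM].
by rewrite mem_submod_cap => /andP[].
Qed.

(** An element outside the largest proper submodule [P] generates [V].

    For [w] outside [P], the [a] with [a w] in [P] form a maximal left ideal, so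
    [J V] is contained in [P].  Conversely fix [u] outside [P], let [L] be the
    left ideal of the [a] with [a u] in [P] and [C] a supplement of [L] modulo
    [J].  The [C]-component [c] of [1] has [c u] outside [P], so every [x] in [P]
    is [r c u] for some [r]; then [r c] lies in [L] and in [C], hence in [J]. *)
Lemma rad_mul_local V (P : submodClosed V) :
    left_artinian R -> P <> submodT V ->
    (forall T : submodClosed V, T <> submodT V -> {subset T <= P}) ->
  rad_mul V = P.
Proof.
move=> artR PT maxP.
have genV w : w \notin P -> cyclic_submod w = submodT V.
  move=> nPw; apply: contrapT => /maxP sub; case/negP: nPw.
  exact/sub/mem_cyclic.
apply: submod_anti.
  move=> _ /asboolP[n [a [x [Jx ->]]]]; apply: rpred_sum => i _; apply: rpredZ.
  have [b [w [Jb ->]]] := Jx i.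
  have [Pw|nPw] := boolP (w \in P); first exact: rpredZ.
  suff /Jb : max_left_ideal (submod_preim (orbit_map w) P) by [].
  split=> [LT|L sL].
    have : (1 : R^o) \in submodT R^o by [].
    by rewrite -LT mem_submod_preim /= orbit_map1; exact/negP.
  have [LwT|/maxP sLP] := pselect (submod_image (orbit_map w) L = submodT V).
    right; have : w \in submod_image (orbit_map w) L by rewrite LwT.
    case/submod_imageP=> l Ll lw c; have L1 : (1 : R^o) \in L.
      rewrite -(subrK l 1) rpredD //; apply: sL.
      by rewrite mem_submod_preim linearB lw /= orbit_map1 subrr rpred0.
    by rewrite -[c]mulr1 [c * 1 \in L]rpredZ.
  left=> c; apply/idP/idP => [Lc|/sL //]; rewrite mem_submod_preim; apply: sLP.
  by apply/submod_imageP; exists c.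
have [u nPu] := not_submodT PT.
have [C [LC sLCJ]] := left_supplement (submod_preim (orbit_map u) P) artR.
have : (1 : R^o) \in submod_add (submod_preim (orbit_map u) P) C by rewrite LC.
case/submod_addP=> l Ll Cc; set c := 1 - l in Cc.
have nPcu : c *: u \notin P.
  apply: contra nPu => Pcu.
  by rewrite -(scale1r u) -(subrK l 1) scalerDl rpredD.
move=> x Px; have : x \in cyclic_submod (c *: u) by rewrite genV.
case/cyclic_submodP=> r def_x; have rcu : orbit_map u (r * c) = x.
  by rewrite def_x; apply/esym; exact: scalerA.
apply/asboolP.
exists 1%N, (fun=> 1), (fun=> x); split=> [_|]; last by rewrite big_ord1 scale1r.
exists (r * c), u; split; last exact: esym rcu.
apply: sLCJ; rewrite mem_submod_cap [X in _ && X]rpredZ // andbT.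
by rewrite mem_submod_preim /= rcu.
Qed.

End Modules.

(** * Irreducible maps into and out of a uniserial module *)

Theorem proposition3p1 (R : pzRingType) (artR : left_artinian R) :
  (forall (M U : lmodType R) (f : {linear M -> U}),
     fin_gen M -> fin_gen U -> uniserial U ->
     irreducible_map f -> injective f ->
     exists phi : {linear submod (rad_mul U) -> M},
       bijective phi /\ forall x, f (phi x) = val x) /\
  (forall (U M : lmodType R) (g : {linear U -> M}),
     fin_gen U -> fin_gen M -> uniserial U ->
     irreducible_map g -> (forall y, exists x, g x = y) ->
     exists psi : {linear M -> quotmod (socle U)},
       bijective psi /\ forall u, psi (g u) = quotmod_proj (socle U) u).
Proof.
split=> [M U f _ _ uniU [nsm nse irr] f_inj | U M g fgU _ uniU [nsm nse irr] g_surj].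
- have [chU fg_sub has_max _] := uniserial_structure uniU.
  pose I := submod_image f (submodT M).
  have If m : f m \in I by apply/submod_imageP; exists m.
  have properI : I <> submodT U.
    move=> IT; have f_surj y : exists x, f x = y.
      have : y \in submodT U by [].
      by rewrite -IT => /submod_imageP[x _ <-]; exists x.
    by have [k [_ fk]] := linear_inverse f_inj f_surj; apply: nse; exists k.
  have [P PT maxP] := has_max I properI.
  have radP := rad_mul_local artR PT maxP.
  have sIP := maxP I properI.
  pose j : {linear submod P -> U} := val.
  have [h jh] : exists h : {linear M -> submod P}, forall m, j (h m) = f m.
    apply: lift_mono => [|m]; first exact: val_inj.
    by exists (Sub (f m) (sIP _ (If m))).
  have surjP p : exists m, f m = j p.
    case: (irr _ j h (fg_sub P)) => [m|[r hK]|[s sK]]; first exact/esym/jh.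
      have [M0|rK] := chain_summand (chain_submod (S := P) chU) hK.
        by case: nsm; exists \0 => m; rewrite [RHS]M0.
      by exists (r p); rewrite -jh; congr (val _); exact: rK.
    case: PT; apply: submod_anti => // u _.
    by rewrite -(sK u); exact: valP (s u).
  rewrite radP.
  have [phi fphi] := lift_mono f_inj surjP.
  exists phi; split=> //; exists h => x.
    by apply: val_inj; exact: etrans (jh _) (fphi _).
  by apply: f_inj; rewrite fphi; exact: jh.
have [chU _ _ has_min] := uniserial_structure uniU.
pose K := submod_preim g (submod0 M).
have K0 : K <> submod0 U.
  move=> K0; have g_inj : injective g.
    apply: ker0_inj => x gx0; apply/eqP; rewrite -mem_submod0 -K0.
    by rewrite mem_submod_preim gx0 rpred0.
  by have [k [gk _]] := linear_inverse g_inj g_surj; apply: nsm; exists k.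
have [Q Q0 minQ] := has_min K K0.
rewrite (socle_least Q0 minQ).
have sQK := minQ K K0.
pose p : {linear U -> quotmod Q} := quotmod_proj Q.
have p_surj (y : quotmod Q) : exists x, p x = y.
  by eexists; exact: quotmod_projK.
have p0 x : p x = 0 <-> x \in Q.
  by have := quotmod_projP Q x 0; rewrite subr0 -[quotmod_proj Q 0]/(p 0) linear0.
have [k kp] : exists k : {linear quotmod Q -> M}, forall x, k (p x) = g x.
  by apply: factor_epi => // x /p0/sQK; rewrite mem_submod_preim => /eqP.
case: (irr _ k p (@fin_gen_quot _ _ Q fgU)) => [x|[r pK]|[s sK]].
- by rewrite /= kp.
- case: Q0; apply: submod_anti; last exact: sub_submod0.
  by move=> x /p0 px0; rewrite mem_submod0 -[x]pK px0 linear0.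
have [M0|kK] := chain_summand (@chain_quot _ _ Q chU) sK.
  by case: nse; exists \0 => m; rewrite [RHS]M0; exact: M0.
exists s; split; first by exists k.
by move=> u; rewrite -kp; exact: kK.
Qed.
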